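(* Let $\mathbb{K}$ be a field of characteristic zero, let $(L,[\cdot,\cdot],\alpha)$ be a multiplicative Hom-Leibniz algebra over $\mathbb{K}$, let $n\ge 1$, and let $(m_t,\alpha_t)$ be a deformation of order $n$ of $L$. Then $(m_t,\alpha_t)$ extends to a deformation of order $n+1$ if and only if the cohomology class of the obstruction $\mathrm{Obs}^n\in\widetilde{CL}^3(L,L)$ vanishes, i.e. $\mathrm{Obs}^n=\partial(\phi,\psi)$ for some $(\phi,\psi)\in\widetilde{CL}^2(L,L)$.
   Context: A Hom-Leibniz algebra over $\mathbb{K}$ is a $\mathbb{K}$-vector space $L$ with a $\mathbb{K}$-bilinear map $[\cdot,\cdot]:L\times L\to L$ and a $\mathbb{K}$-linear map $\alpha:L\to L$ such that $[\alpha(x),[y,z]]=[[x,y],\alpha(z)]-[[x,z],\alpha(y)]$ for all $x,y,z\in L$. It is multiplicative if $\alpha([x,y])=[\alpha(x),\alpha(y)]$. A deformation of order $n$ (an $n$-deformation) of $L$ is a pair $m_t=\sum_{i=0}^n m_it^i$, $\alpha_t=\sum_{i=0}^n\alpha_it^i$ with $m_i:L\times L\to L$ $\mathbb{K}$-bilinear, $\alpha_i:L\to L$ $\mathbb{K}$-linear, $m_0=[\cdot,\cdot]$, $\alpha_0=\alpha$, such that, modulo $t^{n+1}$, $m_t(\alpha_t(x),m_t(y,z))=m_t(m_t(x,y),\alpha_t(z))-m_t(m_t(x,z),\alpha_t(y))$ and $m_t(\alpha_t(x),\alpha_t(y))=\alpha_t(m_t(x,y))$ for all $x,y,z\in L$.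 It extends to a deformation of order $n+1$ if there are a $\mathbb{K}$-bilinear $m_{n+1}:L\times L\to L$ and a $\mathbb{K}$-linear $\alpha_{n+1}:L\to L$ such that $(m_t+m_{n+1}t^{n+1},\ \alpha_t+\alpha_{n+1}t^{n+1})$ is a deformation of order $n+1$. Notation: $(m_i\circ_{\alpha_j}m_k)(x,y,z)=m_i(\alpha_j(x),m_k(y,z))-m_i(m_k(x,y),\alpha_j(z))+m_i(m_k(x,z),\alpha_j(y))$. The obstruction is $\mathrm{Obs}^n=(\mathrm{Obs}^n_\gamma,\mathrm{Obs}^n_\alpha)$ with $\mathrm{Obs}^n_\gamma(x,y,z)=\sum_{i+j+k=n+1,\ 0\le i,j,k\le n}(m_i\circ_{\alpha_j}m_k)(x,y,z)$, $\mathrm{Obs}^n_\alpha(x,y)=-\sum_{i+j+k=n+1,\ 0\le i,j,k\le n}m_i(\alpha_j(x),\alpha_k(y))+\sum_{i+j=n+1,\ i,j>0}\alpha_i(m_j(x,y))$. $\alpha$-type complex: $\widetilde{CL}^2(L,L)=\mathrm{Hom}_{\mathbb{K}}(L^{\otimes2},L)\oplus\mathrm{Hom}_{\mathbb{K}}(L,L)$, $\widetilde{CL}^3(L,L)=\mathrm{Hom}_{\mathbb{K}}(L^{\otimes3},L)\oplus\mathrm{Hom}_{\mathbb{K}}(L^{\otimes2},L)$, and for $(\phi,\psi)\in\widetilde{CL}^2(L,L)$, $\partial(\phi,\psi)=(\partial_{\gamma\gamma}\phi-\partial_{\alpha\gamma}\psi,\ \partial_{\gamma\alpha}\phi-\partial_{\alpha\alpha}\psi)$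 with $(\partial_{\gamma\gamma}\phi)(x,y,z)=[\alpha(x),\phi(y,z)]+[\phi(x,z),\alpha(y)]-[\phi(x,y),\alpha(z)]-\phi([x,y],\alpha(z))+\phi([x,z],\alpha(y))+\phi(\alpha(x),[y,z])$, $(\partial_{\alpha\gamma}\psi)(x,y,z)=[[x,y],\psi(z)]-[[x,z],\psi(y)]-[\psi(x),[y,z]]$, $(\partial_{\gamma\alpha}\phi)(x,y)=\alpha(\phi(x,y))-\phi(\alpha(x),\alpha(y))$, $(\partial_{\alpha\alpha}\psi)(x,y)=[\alpha(x),\psi(y)]+[\psi(x),\alpha(y)]-\psi([x,y])$. *)

(* Defs.v *)
From HB Require Import structures.
From mathcomp Require Import all_boot all_algebra.

Set Implicit Arguments.
Unset Strict Implicit.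
Unset Printing Implicit Defensive.

Import GRing.Theory.
Local Open Scope ring_scope.

Record homLeibniz (K : fieldType) := HomLeibniz {
  carrier :> lmodType K;
  bracket : {bilinear carrier -> carrier -> carrier};
  twist : {linear carrier -> carrier};
  homLeibnizP : forall x y z : carrier,
    bracket (twist x) (bracket y z) =
      bracket (bracket x y) (twist z) - bracket (bracket x z) (twist y)
}.

Arguments bracket {K} L : rename.
Arguments twist {K} L : rename.

Definition multiplicative (K : fieldType) (L : homLeibniz K) : Prop :=
  forall x y : L, twist L (bracket L x y) = bracket L (twist L x) (twist L y).

(* L[[t]] is represented by coefficient sequences nat -> L.  The operators
   sum_(i <= n) a_i t^i and sum_(i <= n) m_i t^i act on it K[[t]]-(bi)linearly,
   i.e. by Cauchy products. *)
Section FormalSeries.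
Variables (K : fieldType) (V : lmodType K).

Definition series_const (x : V) : nat -> V := fun s => if (s == 0)%N then x else 0.

Definition series_sub (u v : nat -> V) : nat -> V := fun s => u s - v s.

Definition series_lin n (a : 'I_n.+1 -> {linear V -> V}) (u : nat -> V) :
    nat -> V :=
  fun s => \sum_(i < n.+1) \sum_(p < s.+1 | (i + p == s)%N) a i (u p).

Definition series_bilin n (m : 'I_n.+1 -> {bilinear V -> V -> V})
    (u v : nat -> V) : nat -> V :=
  fun s => \sum_(i < n.+1) \sum_(p < s.+1)
             \sum_(q < s.+1 | (i + p + q == s)%N) m i (u p) (v q).

(* equality modulo t^N *)
Definition series_eqmod N (u v : nat -> V) : Prop :=
  forall s, (s < N)%N -> u s = v s.

End FormalSeries.

Section Deformations.
Variables (K : fieldType) (L : homLeibniz K).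

Definition is_deformation n (m : 'I_n.+1 -> {bilinear L -> L -> L})
    (a : 'I_n.+1 -> {linear L -> L}) : Prop :=
  let c := @series_const K L in
  let mt := series_bilin m in
  let at_ := series_lin a in
  [/\ m ord0 =2 bracket L,
      a ord0 =1 twist L,
      forall x y z : L, series_eqmod n.+1
        (mt (at_ (c x)) (mt (c y) (c z)))
        (series_sub (mt (mt (c x) (c y)) (at_ (c z)))
                    (mt (mt (c x) (c z)) (at_ (c y)))) &
      forall x y : L, series_eqmod n.+1
        (mt (at_ (c x)) (at_ (c y))) (at_ (mt (c x) (c y)))].

(* f_0, ..., f_n, g *)
Definition extend_family (T : Type) n (f : 'I_n.+1 -> T) (g : T) :
    'I_n.+2 -> T :=
  fun i => if unlift ord_max i is Some j then f j else g.

Definition extends_deformation n (m : 'I_n.+1 -> {bilinear L -> L -> L})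
    (a : 'I_n.+1 -> {linear L -> L}) : Prop :=
  exists (mn : {bilinear L -> L -> L}) (an : {linear L -> L}),
    is_deformation (extend_family m mn) (extend_family a an).

End Deformations.

Section AlphaTypeComplex.
Variables (K : fieldType) (L : homLeibniz K).

Local Notation "[[ x , y ]]" := (bracket L x y) (at level 0).
Local Notation al := (twist L).

Definition trilinear (f : L -> L -> L -> L) : Prop :=
  [/\ forall y z, linear (fun x => f x y z),
      forall x z, linear (fun y => f x y z) &
      forall x y, linear (f x y)].

Definition CL2 : Type := ({bilinear L -> L -> L} * {linear L -> L})%type.

(* CL^3 consists of the pairs satisfying in_CL3, compared componentwise and
   pointwise by eq_CL3. *)
Definition preCL3 : Type := ((L -> L -> L -> L) * (L -> L -> L))%type.

Definition in_CL3 (c : preCL3) : Prop :=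
  trilinear c.1 /\ bilinear_for *:%R *:%R c.2.

Definition eq_CL3 (c d : preCL3) : Prop :=
  (forall x y z, c.1 x y z = d.1 x y z) /\ c.2 =2 d.2.

Definition d_gg (phi : {bilinear L -> L -> L}) (x y z : L) : L :=
  [[al x, phi y z]] + [[phi x z, al y]] - [[phi x y, al z]]
  - phi [[x, y]] (al z) + phi [[x, z]] (al y) + phi (al x) [[y, z]].

Definition d_ag (psi : {linear L -> L}) (x y z : L) : L :=
  [[ [[x, y]], psi z]] - [[ [[x, z]], psi y]] - [[psi x, [[y, z]]]].

Definition d_ga (phi : {bilinear L -> L -> L}) (x y : L) : L :=
  al (phi x y) - phi (al x) (al y).

Definition d_aa (psi : {linear L -> L}) (x y : L) : L :=
  [[al x, psi y]] + [[psi x, al y]] - psi [[x, y]].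

Definition d_CL (c : CL2) : preCL3 :=
  (fun x y z => d_gg c.1 x y z - d_ag c.2 x y z,
   fun x y => d_ga c.1 x y - d_aa c.2 x y).

Definition is_coboundary (c : preCL3) : Prop :=
  exists p : CL2, eq_CL3 c (d_CL p).

Definition hcomp (mi : {bilinear L -> L -> L}) (aj : {linear L -> L})
    (mk : {bilinear L -> L -> L}) (x y z : L) : L :=
  mi (aj x) (mk y z) - mi (mk x y) (aj z) + mi (mk x z) (aj y).

Definition Obs n (m : 'I_n.+1 -> {bilinear L -> L -> L})
    (a : 'I_n.+1 -> {linear L -> L}) : preCL3 :=
  (fun x y z => \sum_(i < n.+1) \sum_(j < n.+1)
      \sum_(k < n.+1 | (i + j + k == n.+1)%N) hcomp (m i) (a j) (m k) x y z,
   fun x y =>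
     - (\sum_(i < n.+1) \sum_(j < n.+1)
          \sum_(k < n.+1 | (i + j + k == n.+1)%N) m i (a j x) (a k y))
     + \sum_(i < n.+1 | (0 < i)%N)
         \sum_(j < n.+1 | (0 < j)%N && (i + j == n.+1)%N) a i (m j x y)).

Lemma lin_id : linear (fun x : L => x).
Proof. by []. Qed.

Lemma lin_D (f g : L -> L) :
  linear f -> linear g -> linear (fun x => f x + g x).
Proof. by move=> hf hg k u v; rewrite hf hg scalerDr addrACA. Qed.

Lemma lin_N (f : L -> L) : linear f -> linear (fun x => - f x).
Proof. by move=> hf k u v; rewrite hf opprD scalerN. Qed.

Lemma lin_sum (I : finType) (P : pred I) (f : I -> L -> L) :
  (forall i, linear (f i)) -> linear (fun x => \sum_(i | P i) f i x).
Proof.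
move=> hf k u v; rewrite scaler_sumr -big_split /=.
by apply: eq_bigr => i _; rewrite hf.
Qed.

Lemma lin_lin (g : {linear L -> L}) (f : L -> L) :
  linear f -> linear (fun x => g (f x)).
Proof. by move=> hf k u v; rewrite hf linearP. Qed.

Lemma lin_bl (g : {bilinear L -> L -> L}) (f : L -> L) z :
  linear f -> linear (fun x => g (f x) z).
Proof. by move=> hf k u v; rewrite hf linearPl. Qed.

Lemma lin_br (g : {bilinear L -> L -> L}) (f : L -> L) z :
  linear f -> linear (fun x => g z (f x)).
Proof. by move=> hf k u v; rewrite hf linearPr. Qed.

Local Ltac lin := repeat first
  [ exact: lin_id | apply: lin_D | apply: lin_N | apply: lin_sum => ?
  | apply: lin_bl | apply: lin_br | apply: lin_lin ].

Lemma d_CL_in_CL3 p : in_CL3 (d_CL p).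
Proof.
by split; split => ? *; rewrite /d_CL /d_gg /d_ag /d_ga /d_aa /applyr /=; lin.
Qed.

Lemma Obs_in_CL3 n (m : 'I_n.+1 -> {bilinear L -> L -> L})
    (a : 'I_n.+1 -> {linear L -> L}) : in_CL3 (Obs m a).
Proof. by split; split => ? *; rewrite /Obs /hcomp /applyr /=; lin. Qed.

End AlphaTypeComplex.

(* Main.v *)
(* Comparing coefficients of t^s turns the deformation axioms into one identity
   per s, summed over indices i + j + k = s.  The identities for s <= n do not
   see the new terms (m_{n+1}, a_{n+1}) = (phi, psi).  For s = n+1 a triple
   containing the index n+1 has its other two indices 0, and these triples add
   up to d(phi, psi), the others to Obs^n.  So the extension exists iff
   Obs^n + d(phi, psi) = 0, i.e. Obs^n = d(-phi, -psi), is solvable. *)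

From HB Require Import structures.
From mathcomp Require Import all_boot all_algebra zify.
Import GRing.Theory.
(* Defs comes last: GRing.Theory would otherwise shadow [multiplicative]. *)
Require Import Defs.

Set Implicit Arguments.
Unset Strict Implicit.
Unset Printing Implicit Defensive.

Local Open Scope ring_scope.

(** * Sums over index triples and pairs of prescribed total *)

(** Nesting and filter are those of [Obs], whose triple sums are thus instances by mere
    unfolding. *)
Definition sum3 (V : nmodType) n s (F : 'I_n -> 'I_n -> 'I_n -> V) : V :=
  \sum_(i < n) \sum_(j < n) \sum_(k < n | (i + j + k == s)%N) F i j k.

Definition sum2 (V : nmodType) n s (F : 'I_n -> 'I_n -> V) : V :=
  \sum_(i < n) \sum_(k < n | (i + k == s)%N) F i k.

(** An index k with r + k = s is met by exactly one position q, namely q = k, which is in range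
    since k <= s. This trades positions in a series for indices of a family. *)
Lemma big_ord_shift_nat (V : nmodType) n s r (g : 'I_n -> V) :
  \sum_(q < s.+1 | (r + q == s)%N) \sum_(k < n | k == q :> nat) g k =
  \sum_(k < n | (r + k == s)%N) g k.
Proof.
rewrite (exchange_big_dep xpredT) //= [RHS]big_mkcond /=.
apply: eq_bigr => k _; case: ifPn => [/eqP rks | rks].
  have ks : (k < s.+1)%N by lia.
  rewrite (big_pred1 (Ordinal ks)) // => q /=.
  by rewrite -val_eqE /=; lia.
by rewrite big_pred0 // => q; lia.
Qed.

(** * Coefficients of composed series *)

Section Coefficients.
Variables (K : fieldType) (V : lmodType K) (n : nat).
Variables (m : 'I_n.+1 -> {bilinear V -> V -> V}).
Variables (a : 'I_n.+1 -> {linear V -> V}).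

(** Only position 0 of a constant series contributes. A sum with at most one term also covers p > n,
    where the coefficient is 0. *)
Lemma series_lin_const x p :
  series_lin a (series_const x) p = \sum_(i < n.+1 | i == p :> nat) a i x.
Proof.
rewrite /series_lin [RHS]big_mkcond /=; apply: eq_bigr => i _.
rewrite big_mkcond big_ord_recl /= addn0 big1 ?addr0 // => q _.
by rewrite /series_const /= linear0 if_same.
Qed.

Lemma series_bilin_const x y p :
  series_bilin m (series_const x) (series_const y) p =
  \sum_(i < n.+1 | i == p :> nat) m i x y.
Proof.
rewrite /series_bilin [RHS]big_mkcond /=; apply: eq_bigr => i _.
rewrite big_ord_recl [X in _ + X]big1 ?addr0 => [|q _].
  rewrite big_mkcond big_ord_recl /= !addn0 big1 ?addr0 // => q _.
  by rewrite /series_const /= linear0r if_same.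
by rewrite big1 // => q' _; rewrite /series_const /= linear0l.
Qed.

Lemma series_linE (g : 'I_n.+1 -> V) v s :
  (forall q, v q = \sum_(k < n.+1 | k == q :> nat) g k) ->
  series_lin a v s = sum2 s (fun i k => a i (g k)).
Proof.
move=> vE; apply: eq_bigr => i _; rewrite -big_ord_shift_nat.
by apply: eq_bigr => q _; rewrite vE linear_sum.
Qed.

(** The hypotheses have the shape delivered by the lemmas on constant series, so nested products can
    be expanded from the inside out. *)
Lemma series_bilinE (f g : 'I_n.+1 -> V) u v s :
  (forall p, u p = \sum_(j < n.+1 | j == p :> nat) f j) ->
  (forall q, v q = \sum_(k < n.+1 | k == q :> nat) g k) ->
  series_bilin m u v s = sum3 s (fun i j k => m i (f j) (g k)).
Proof.
move=> uE vE; apply: eq_bigr => i _.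
(* Here q has been absorbed into the index k, while p still runs alongside j. *)
transitivity (\sum_(p < s.+1) \sum_(j < n.+1 | j == p :> nat)
   \sum_(k < n.+1 | (i + j + k == s)%N) m i (f j) (g k)).
  apply: eq_bigr => p _; rewrite uE.
  transitivity (\sum_(k < n.+1 | (i + p + k == s)%N)
      \sum_(j < n.+1 | j == p :> nat) m i (f j) (g k)).
    rewrite -[RHS]big_ord_shift_nat; apply: eq_bigr => q _.
    rewrite vE linear_sumr; apply: eq_bigr => k _.
    by rewrite linear_sumlz.
  by rewrite exchange_big /=; apply: eq_bigr => j /eqP ->.
rewrite (exchange_big_dep xpredT) //=; apply: eq_bigr => j _.
(* If j <= s, the only position is p = j; if j > s, both sides are empty. *)
case: (leqP j s) => js.
  by rewrite (big_pred1 (Ordinal (js : (j < s.+1)%N))) // => p; rewrite eq_sym.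
by rewrite !big_pred0 // => p; apply/negbTE/eqP; case: p => p /= ?; lia.
Qed.

End Coefficients.

(** * Splitting off the terms that contain the top index *)

Section Sums.
Variables (V : zmodType) (n : nat).

Local Notation w := (widen_ord (leqnSn n.+1)).

Lemma eq_sum2 N s (F G : 'I_N -> 'I_N -> V) :
  (forall i j, F i j = G i j) -> sum2 s F = sum2 s G.
Proof. by move=> FG; do 2!apply: eq_bigr => ? _. Qed.

Lemma eq_sum3 N s (F G : 'I_N -> 'I_N -> 'I_N -> V) :
  (forall i j k, F i j k = G i j k) -> sum3 s F = sum3 s G.
Proof. by move=> FG; do 3!apply: eq_bigr => ? _. Qed.

Lemma sum3D N s (F G : 'I_N -> 'I_N -> 'I_N -> V) :
  sum3 s (fun i j k => F i j k + G i j k) = sum3 s F + sum3 s G.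
Proof. by rewrite /sum3 -big_split; apply: eq_bigr => i _;
 rewrite -big_split; apply: eq_bigr => j _; rewrite -big_split. Qed.

Lemma sum3N N s (F : 'I_N -> 'I_N -> 'I_N -> V) :
  sum3 s (fun i j k => - F i j k) = - sum3 s F.
Proof. by rewrite /sum3 -sumrN; apply: eq_bigr => i _;
 rewrite -sumrN; apply: eq_bigr => j _; rewrite -sumrN. Qed.

(** As s <= n+1, the top index n+1 leaves room only for a 0 beside it, and only when s = n+1. *)
Lemma sum2_recr s (F : 'I_n.+2 -> 'I_n.+2 -> V) : (s <= n.+1)%N ->
  sum2 s F = sum2 s (fun i j => F (w i) (w j)) +
    (if s == n.+1 then F ord_max ord0 + F ord0 ord_max else 0).
Proof.
move=> sn; rewrite /sum2 big_ord_recr /=.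
under eq_bigr => i _ do rewrite big_mkcond big_ord_recr -big_mkcond /=.
rewrite big_split /= -addrA; congr (_ + _).
rewrite [X in X + _]big_ord_recl /= [X in _ + X + _]big1 ?addr0 => [|i _]; last first.
  by rewrite /= /bump /=; case: ifP => //; lia.
have -> : w ord0 = ord0 by apply: val_inj.
rewrite big_mkcond big_ord_recl /= [X in _ + (_ + X)]big1 ?addr0 => [|i _]; last first.
  by rewrite /= /bump /=; case: ifP => //; lia.
rewrite add0n addn0 [(n.+1 == s)%N]eq_sym.
by case: ifP => _; rewrite ?addr0 // addrC.
Qed.

Lemma sum3_recr s (F : 'I_n.+2 -> 'I_n.+2 -> 'I_n.+2 -> V) : (s <= n.+1)%N ->
  sum3 s F = sum3 s (fun i j k => F (w i) (w j) (w k)) +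
    (if s == n.+1 then
       F ord_max ord0 ord0 + F ord0 ord_max ord0 + F ord0 ord0 ord_max
     else 0).
Proof.
move=> sn.
have inner (i j : 'I_n.+2) : \sum_(k < n.+2 | (i + j + k == s)%N) F i j k =
   \sum_(k < n.+1 | (i + j + k == s)%N) F i j (w k) +
   (if (i + j + n.+1 == s)%N then F i j ord_max else 0).
  by rewrite big_mkcond big_ord_recr -big_mkcond.
(* Once i + j = n+1, only k = 0 keeps the total within s. *)
have top (i j : 'I_n.+2) : (i + j)%N = n.+1 ->
   \sum_(k < n.+1 | (i + j + k == s)%N) F i j (w k) =
   if s == n.+1 then F i j ord0 else 0.
  move=> ij; rewrite big_mkcond big_ord_recl big1 ?addr0 => [|k _]; last first.
    by rewrite /= /bump /=; case: ifP => //; lia.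
  have -> : w ord0 = ord0 by apply: val_inj.
  by rewrite /= addr0 ij addn0 eq_sym.
rewrite /sum3; under eq_bigr => i _.
  under eq_bigr => j _ do rewrite inner.
  rewrite big_split /= big_ord_recr /=.
  over.
rewrite /= big_split /= big_split /= -!addrA big_ord_recr /= -addrA; congr (_ + _).
(* The remainder is sorted by the last position holding the top index: first i, then j, then k. Each
   part reduces to one triple. *)
have -> : \sum_(j < n.+1) \sum_(k < n.+1 | (n.+1 + j + k == s)%N)
    F ord_max (w j) (w k) = if s == n.+1 then F ord_max ord0 ord0 else 0.
  rewrite big_ord_recl [X in _ + X]big1 ?addr0 => [|j _]; last first.
    by rewrite big_pred0 // => k; rewrite /= /bump /=; lia.
  have -> : w ord0 = ord0 by apply: val_inj.
  by rewrite (top ord_max ord0) //= addn0.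
have -> : \sum_(i < n.+2) \sum_(k < n.+1 | (i + n.+1 + k == s)%N)
    F i ord_max (w k) = if s == n.+1 then F ord0 ord_max ord0 else 0.
  rewrite big_ord_recl [X in _ + X]big1 ?addr0 => [|j _]; last first.
    by rewrite big_pred0 // => k; rewrite /= /bump /=; lia.
  by rewrite (top ord0 ord_max) //=.
have -> : \sum_(i < n.+2) \sum_(j < n.+2)
    (if (i + j + n.+1 == s)%N then F i j ord_max else 0) =
    if s == n.+1 then F ord0 ord0 ord_max else 0.
  rewrite big_ord_recl [X in _ + X]big1 ?addr0 => [|i _]; last first.
    by rewrite big1 // => j _; rewrite /= /bump /=; case: ifP => //; lia.
  rewrite big_ord_recl [X in _ + X]big1 ?addr0 => [|i _]; last first.
    by rewrite /= /bump /=; case: ifP => //; lia.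
  by rewrite /= !add0n eq_sym.
by case: ifP; rewrite ?addr0.
Qed.

End Sums.

(** The condition i + j + k = s is symmetric in j and k. The swap is needed because [hcomp] gives j
    to the twist and k to the inner product, while product series number their arguments from left
    to right. *)
Lemma sum3_swap (V : nmodType) N s (F : 'I_N -> 'I_N -> 'I_N -> V) :
  sum3 s (fun i j k => F i k j) = sum3 s F.
Proof.
apply: eq_bigr => i _; rewrite (exchange_big_dep xpredT) //=.
by apply: eq_bigr => k _; apply: eq_bigl => j; rewrite addnAC.
Qed.

(** * The deformation axioms, coefficient by coefficient *)

Section Equations.
Variables (K : fieldType) (L : homLeibniz K).

Lemma is_deformationE n (m : 'I_n.+1 -> {bilinear L -> L -> L})
    (a : 'I_n.+1 -> {linear L -> L}) :
  is_deformation m a <->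
  [/\ m ord0 =2 bracket L,
      a ord0 =1 twist L,
      forall x y z s, (s < n.+1)%N ->
        sum3 s (fun i j k => hcomp (m i) (a j) (m k) x y z) = 0 &
      forall x y s, (s < n.+1)%N ->
        sum2 s (fun i j => a i (m j x y)) =
        sum3 s (fun i j k => m i (a j x) (a k y))].
Proof.
have linE := series_lin_const a; have bilE := series_bilin_const m.
have hcompE x y z s :
  sum3 s (fun i j k => hcomp (m i) (a j) (m k) x y z) =
  sum3 s (fun i j k => m i (a j x) (m k y z)) -
  (sum3 s (fun i j k => m i (m j x y) (a k z)) -
   sum3 s (fun i j k => m i (m j x z) (a k y))).
  rewrite /hcomp sum3D sum3D sum3N opprB addrA addrAC.
  by rewrite -!(sum3_swap _ (fun i j k => m i (m j _ _) _)).
have mulE x y s : series_bilin m (series_lin a (series_const x))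
    (series_lin a (series_const y)) s =
  sum3 s (fun i j k => m i (a j x) (a k y)).
  by apply: series_bilinE => p; apply: linE.
have leibE x y z s : series_bilin m (series_lin a (series_const x))
    (series_bilin m (series_const y) (series_const z)) s =
  sum3 s (fun i j k => m i (a j x) (m k y z)).
  by apply: series_bilinE => p; [apply: linE | apply: bilE].
have leibE' x y z s : series_bilin m
    (series_bilin m (series_const x) (series_const y))
    (series_lin a (series_const z)) s =
  sum3 s (fun i j k => m i (m j x y) (a k z)).
  by apply: series_bilinE => p; [apply: bilE | apply: linE].
have twE x y s : series_lin a
    (series_bilin m (series_const x) (series_const y)) s =
  sum2 s (fun i j => a i (m j x y)).
  by apply: series_linE => p; apply: bilE.
split=> -[m0 a0 leib mult]; split=> // x y.
- by move=> z s sn; rewrite hcompE -leibE (leib _ _ _ _ sn) /series_sub !leibE' subrr.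
- by move=> s sn; rewrite -twE -mulE mult.
- move=> z s sn; rewrite /series_sub leibE !leibE'.
  by apply/eqP; rewrite -subr_eq0 -hcompE leib.
- by move=> s sn; rewrite twE mulE mult.
Qed.

Lemma extend_family_max (T : Type) n (f : 'I_n.+1 -> T) g :
  extend_family f g ord_max = g.
Proof. by rewrite /extend_family unlift_none. Qed.

Lemma extend_family_widen (T : Type) n (f : 'I_n.+1 -> T) g i :
  extend_family f g (widen_ord (leqnSn n.+1) i) = f i.
Proof.
have -> : widen_ord (leqnSn n.+1) i = lift ord_max i.
  by apply: val_inj; rewrite /= /bump leqNgt ltn_ord.
by rewrite /extend_family liftK.
Qed.

Lemma extend_family0 (T : Type) n (f : 'I_n.+1 -> T) g :
  extend_family f g ord0 = f ord0.
Proof.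
by rewrite -(extend_family_widen f g); congr extend_family; apply: val_inj.
Qed.

(** * The coefficient identities of an extended family *)

Section Extension.
Variables (n : nat) (m : 'I_n.+1 -> {bilinear L -> L -> L}).
Variables (a : 'I_n.+1 -> {linear L -> L}).
Variables (phi : {bilinear L -> L -> L}) (psi : {linear L -> L}).
Hypothesis def_ma : is_deformation m a.

Local Notation M := (extend_family m phi).
Local Notation A := (extend_family a psi).

Lemma extend_leibniz x y z s : (s <= n.+1)%N ->
  sum3 s (fun i j k => hcomp (M i) (A j) (M k) x y z) =
  if s == n.+1 then (Obs m a).1 x y z + (d_CL (phi, psi)).1 x y z else 0.
Proof.
have [m0 a0 leib _] := (is_deformationE m a).1 def_ma.
move=> sn; rewrite sum3_recr // !extend_family_max !extend_family0.
under eq_sum3 => i j k do rewrite !extend_family_widen.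
case: eqP => [-> | /eqP sn1]; last by rewrite addr0 leib //; lia.
congr (_ + _); rewrite /d_CL /d_gg /d_ag /hcomp /= !m0 !a0.
rewrite !(opprD, opprB, opprK, addrA).
(* Summands 1 to 3 have [phi] as outer product, 4 to 6 have [psi] as twist, 7 to 9 have [phi] as
   inner product; they are put in the order of [d_gg], then [d_ag]. *)
by rewrite [LHS](ACl (7*9*8*2*3*1*6*5*4)%AC).
Qed.

Lemma extend_mult x y s : (s <= n.+1)%N ->
  sum2 s (fun i j => A i (M j x y)) - sum3 s (fun i j k => M i (A j x) (A k y)) =
  if s == n.+1 then (Obs m a).2 x y + (d_CL (phi, psi)).2 x y else 0.
Proof.
have [m0 a0 _ mult] := (is_deformationE m a).1 def_ma.
move=> sn; rewrite sum3_recr // sum2_recr // !extend_family_max !extend_family0.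
under eq_sum3 => i j k do rewrite !extend_family_widen.
under eq_sum2 => i j do rewrite !extend_family_widen.
case: eqP => [-> | /eqP sn1]; last by rewrite !addr0 mult ?subrr //; lia.
(* With i, j <= n, a total of n+1 forces both indices to be positive, as in the filter of [Obs]. *)
have -> : sum2 n.+1 (fun i j => a i (m j x y)) =
  \sum_(i < n.+1 | (0 < i)%N)
     \sum_(j < n.+1 | (0 < j)%N && (i + j == n.+1)%N) a i (m j x y).
  rewrite [RHS]big_mkcond /=; apply: eq_bigr => i _.
  case: ifP => i0; last by rewrite big_pred0 // => j; have := ltn_ord j; lia.
  by apply: eq_bigl => j; have := ltn_ord i; lia.
rewrite /d_CL /d_ga /d_aa /Obs /= !m0 !a0 -/(sum3 _ _).
rewrite !(opprD, opprB, opprK, addrA).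
by rewrite [LHS](ACl (4*1*3*5*7*6*2)%AC).
Qed.

End Extension.
End Equations.

(** * Sign change on 2-cochains *)

Section Opposite.
Variables (K : fieldType) (L : homLeibniz K).

Definition opp_bilin (phi : {bilinear L -> L -> L}) (x y : L) : L := - phi x y.

Lemma opp_bilin_subproof phi : bilinear_for *:%R *:%R (opp_bilin phi).
Proof.
by split=> z k x y; rewrite /= /opp_bilin ?linearPl ?linearPr opprD scalerN.
Qed.

HB.instance Definition _ (phi : {bilinear L -> L -> L}) :=
  bilinear_isBilinear.Build K L L L *:%R *:%R (opp_bilin phi)
    (opp_bilin_subproof phi).

Definition opp_CL2 (p : CL2 L) : CL2 L :=
  (opp_bilin p.1 : {bilinear L -> L -> L}, \- p.2 : {linear L -> L}).

(** Each term of the differential contains [phi] or [psi] exactly once, in a linear position. *)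
Lemma d_CLN p :
  (forall x y z, (d_CL (opp_CL2 p)).1 x y z = - (d_CL p).1 x y z) /\
  (forall x y, (d_CL (opp_CL2 p)).2 x y = - (d_CL p).2 x y).
Proof.
split=> *; rewrite /d_CL /d_gg /d_ag /d_ga /d_aa /= /opp_bilin.
  by rewrite !(linearNr, linearNl) !(opprD, opprK).
by rewrite linearN !(linearNr, linearNl) !(opprD, opprK).
Qed.

End Opposite.

Unset Implicit Arguments.

(** * Extensions as solutions of the coboundary equation *)

Theorem theorem5p5 (K : fieldType) (charK0 : [pchar K] =i pred0)
    (L : homLeibniz K) (multL : multiplicative L)
    (n : nat) (n_ge1 : (1 <= n)%N)
    (m : 'I_n.+1 -> {bilinear L -> L -> L}) (a : 'I_n.+1 -> {linear L -> L})
    (def_ma : is_deformation m a) :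
  extends_deformation m a <-> is_coboundary (Obs m a).
Proof.
have [m0 a0 _ _] := (is_deformationE m a).1 def_ma.
split=> [[phi [psi /is_deformationE[_ _ leib mult]]] | [p [Obs1 Obs2]]].
  exists (opp_CL2 (phi, psi)); split=> [x y z | x y].
    apply/eqP; rewrite (d_CLN _).1 -addr_eq0.
    by have := extend_leibniz phi psi def_ma x y z (leqnn _); rewrite eqxx leib // => <-.
  apply/eqP; rewrite (d_CLN _).2 -addr_eq0.
  by have := extend_mult phi psi def_ma x y (leqnn _); rewrite eqxx mult // subrr => <-.
(* With -p as new terms, the identities at s = n+1 read Obs - dp = 0; those at s <= n are
   inherited. *)
exists (opp_CL2 p).1, (opp_CL2 p).2; apply/is_deformationE; split.
- by move=> x y; rewrite extend_family0 m0.
- by move=> x; rewrite extend_family0 a0.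
- move=> x y z s sn; rewrite extend_leibniz // -surjective_pairing (d_CLN p).1.
  by rewrite Obs1 subrr if_same.
move=> x y s sn; apply/eqP; rewrite -subr_eq0 extend_mult //.
by rewrite -surjective_pairing (d_CLN p).2 Obs2 subrr if_same.
Qed.
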